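(* Let $S$ be a well-behaved augmented PLTL-clause set. If $S$ is unsatisfiable, then the temporal resolution procedure (step resolution, the rewriting of clauses with right-hand side $\bigcirc\mathbf{false}$, simplification, subsumption, and temporal resolution, as described in the context) applied to $S$ derives the clause $\mathbf{start}\Rightarrow\mathbf{false}$.
   Context: PLTL formulae are built from proposition symbols, the constants $\mathbf{true}$, $\mathbf{false}$, the connectives $\neg,\vee,\wedge,\Rightarrow$ and the temporal operators $\bigcirc$ (next), $\Diamond$ (sometime), $\Box$ (always), $\mathcal{U}$ (until), $\mathcal{W}$ (unless). A model is an infinite sequence $\sigma=s_0,s_1,\dots$ of sets of proposition symbols; $(\sigma,i)\models p$ iff $p\in s_i$; Boolean connectives as usual; $(\sigma,i)\models\bigcirc A$ iff $(\sigma,i+1)\models A$; $(\sigma,i)\models\Diamond A$ iff $(\sigma,k)\models A$ for some $k\ge i$; $(\sigma,i)\models\Box A$ iff $(\sigma,j)\models A$ for all $j\ge i$; $(\sigma,i)\models A\,\mathcal{U}\,B$ iff some $k\ge i$ has $(\sigma,k)\models B$ and $(\sigma,j)\models A$ for all $i\le j<k$; $A\,\mathcal{W}\,B$ holds iff $A\,\mathcal{U}\,B$ or $\Box A$ holds. The nullary connective $\mathbf{start}$ holds exactly at index $0$. A formula is satisfiable if it holds at index $0$ of some model. A literal is a proposition symbol or its negation. A PLTL-clause has one of the forms $\mathbf{start}\Rightarrow\bigvee_c l_c$ (initial), $\bigwedge_a k_a\Rightarrow\bigcirc\bigvee_d l_d$ (step), $\bigwedge_b k_b\Rightarrow\Diamond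 l$ (sometime), with all $k_a,k_b,l_c,l_d,l$ literals (empty conjunction $=\mathbf{true}$, empty disjunction $=\mathbf{false}$). A set $\{A_i\}$ of PLTL-clauses denotes $\Box\bigwedge_i A_i$ (satisfiable/has a model accordingly). The literal $l$ of a sometime clause $C\Rightarrow\Diamond l$ is an eventuality literal. For a conjunction of literals $C$, $\neg C$ denotes the disjunction of the complementary literals. Augmentation: for a finite set $S_0$ of PLTL-clauses, $Aug(S_0)$ is obtained by introducing for each eventuality literal $l$ of $S_0$ a new proposition symbol $w_l$, adding $w_l\Rightarrow\bigcirc(l\vee w_l)$, and for each sometime clause $C\Rightarrow\Diamond l$ adding $\mathbf{start}\Rightarrow\neg C\vee l\vee w_l$ and $\mathbf{true}\Rightarrow\bigcirc(\neg C\vee l\vee w_l)$. An augmented PLTL-clause set is a set $Aug(S_0)$, possibly extended by clauses derived by the rules below (these never introduce new proposition symbols). A normal model of an augmented set is a model of it satisfying $\Box(w_l\Leftrightarrow(\neg l\wedge\Diamond l))$ for every eventuality literal $l$; the set is well-behaved if it is unsatisfiable or has a normal model. Rules. Merging: every step clause is an SNF$_m$ clause, and from SNF$_m$ clauses $A\Rightarrow\bigcirc C$, $B\Rightarrow\bigcirc D$ one forms the SNF$_m$ clause $(A\wedge B)\Rightarrow\bigcirc(C\wedge D)$. Step resolution: from $\mathbf{start}\Rightarrow A\vee p$ and $\mathbf{start}\Rightarrow B\vee\neg p$ derive $\mathbf{start}\Rightarrow A\vee B$; from $C\Rightarrow\bigcirc(A\vee p)$ and $D\Rightarrow\bigcirc(B\vee\neg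 p)$ derive $(C\wedge D)\Rightarrow\bigcirc(A\vee B)$ ($A,B$ disjunctions of literals, $C,D$ conjunctions of literals, $p$ a proposition symbol). A clause $A\Rightarrow\bigcirc\mathbf{false}$ is replaced by $\mathbf{start}\Rightarrow\neg A$ and $\mathbf{true}\Rightarrow\bigcirc\neg A$. Simplification: $(l\wedge A\wedge l)\Rightarrow\bigcirc B$ becomes $(l\wedge A)\Rightarrow\bigcirc B$; $(l\wedge A\wedge\neg l)\Rightarrow\bigcirc B$ and $(A\wedge\mathbf{false})\Rightarrow\bigcirc B$ become $\mathbf{false}\Rightarrow\bigcirc B$; $(A\wedge\mathbf{true})\Rightarrow\bigcirc B$ becomes $A\Rightarrow\bigcirc B$; $A\Rightarrow\bigcirc(l\vee B\vee l)$ becomes $A\Rightarrow\bigcirc(l\vee B)$; $A\Rightarrow\bigcirc(l\vee B\vee\neg l)$ and $A\Rightarrow\bigcirc(B\vee\mathbf{true})$ become $A\Rightarrow\bigcirc\mathbf{true}$; $A\Rightarrow\bigcirc(B\vee\mathbf{false})$ becomes $A\Rightarrow\bigcirc B$; clauses $\mathbf{false}\Rightarrow\bigcirc A$ and $A\Rightarrow\bigcirc\mathbf{true}$ are deleted. Subsumption: if the set contains $C\Rightarrow A$ and $D\Rightarrow B$ with $\vdash C\Rightarrow D$ and $\vdash B\Rightarrow A$, then $C\Rightarrow A$ may be deleted. Temporal resolution: given a sometime clause $C\Rightarrow\Diamond l$ of the set and SNF$_m$ clauses $A_i\Rightarrow\bigcirc B_i$ ($0\le i\le n$) formed by merging step clauses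 of the set, such that for every $i$ both $B_i\Rightarrow\neg l$ and $B_i\Rightarrow\bigvee_{j=0}^n A_j$ are classical propositional tautologies (a loop in $\neg l$), add for each $i$ the loop resolvents $\mathbf{start}\Rightarrow\neg C\vee l\vee\neg A_i$, $\mathbf{true}\Rightarrow\bigcirc(\neg C\vee l\vee\neg A_i)$, and $w_l\Rightarrow\bigcirc(l\vee\neg A_i)$. *)

(* Defs.v *)
From Stdlib Require Import Relations.
From HB Require Import structures.
From mathcomp Require Import all_boot finmap.

Set Implicit Arguments.
Unset Strict Implicit.
Unset Printing Implicit Defensive.

Local Open Scope fset_scope.

Inductive formula (P : Type) : Type :=
  | Prop_ of P
  | True_
  | False_
  | Start
  | Not of formula P
  | Or of formula P & formula P
  | And of formula P & formula P
  | Imp of formula P & formula P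
  | Next of formula P
  | Eventually of formula P
  | Always of formula P
  | Until of formula P & formula P
  | Unless of formula P & formula P.
Arguments True_ {P}.
Arguments False_ {P}.
Arguments Start {P}.

(* A model is an infinite sequence of sets of proposition symbols. *)
Definition model (P : Type) := nat -> pred P.

Fixpoint holds (P : Type) (sigma : model P) (i : nat) (A : formula P) : Prop :=
  match A with
  | Prop_ p => sigma i p
  | True_ => True
  | False_ => False
  | Start => i = 0
  | Not A => ~ holds sigma i A
  | Or A B => holds sigma i A \/ holds sigma i B
  | And A B => holds sigma i A /\ holds sigma i B
  | Imp A B => holds sigma i A -> holds sigma i B
  | Next A => holds sigma i.+1 A
  | Eventually A => exists2 k, i <= k & holds sigma k A
  | Always A => forall j, i <= j -> holds sigma j A
  | Until A B => exists k, [/\ i <= k, holds sigma k B &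
                   forall j, i <= j -> j < k -> holds sigma j A]
  | Unless A B => (exists k, [/\ i <= k, holds sigma k B &
                     forall j, i <= j -> j < k -> holds sigma j A])
                  \/ (forall j, i <= j -> holds sigma j A)
  end.

Definition satisfiable (P : Type) (A : formula P) : Prop :=
  exists sigma : model P, holds sigma 0 A.

(* Validity is truth at every index of every model, not only at index 0:
   since [Start] is a formula the two differ, and clauses live under an
   [Always]. *)
Definition valid (P : Type) (A : formula P) : Prop :=
  forall (sigma : model P) (i : nat), holds sigma i A.

(* [(p, true)] is the literal p, [(p, false)] its negation. *)
Definition literal (P : choiceType) : Type := (P * bool)%type.
HB.instance Definition _ (P : choiceType) := Choice.on (literal P).

Definition compl (P : choiceType) (l : literal P) : literal P := (l.1, ~~ l.2).

Definition compls (P : choiceType) (K : {fset literal P}) : {fset literal P} :=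
  [fset compl l | l in K].

(* Conjunctions and disjunctions of literals are finite sets of literals, hence
   are taken modulo associativity, commutativity and idempotence; the empty
   conjunction is true and the empty disjunction is false. *)
Inductive clause (P : choiceType) : Type :=
  | Initial of {fset literal P}
  | Step of {fset literal P} & {fset literal P}
  | Sometime of {fset literal P} & literal P.

Section ClauseChoice.
Variable P : choiceType.

(* Sealed so that equality tests on clauses do not unfold. *)
Fact clause_encode_key : unit. Proof. exact: tt. Qed.
Definition clause_encode (c : clause P) :
    {fset literal P} + ({fset literal P} * {fset literal P} +
                        {fset literal P} * literal P) :=
  locked_with clause_encode_key match c with
  | Initial D => inl D
  | Step K D => inr (inl (K, D))
  | Sometime K l => inr (inr (K, l))
  end.

Definition clause_decode (x : {fset literal P} +
    ({fset literal P} * {fset literal P} + {fset literal P} * literal P)) :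
    clause P :=
  match x with
  | inl D => Initial D
  | inr (inl (K, D)) => Step K D
  | inr (inr (K, l)) => Sometime K l
  end.

Lemma clause_encodeK : cancel clause_encode clause_decode.
Proof. by move=> c; rewrite /clause_encode locked_withE; case: c. Qed.

HB.instance Definition _ := Choice.copy (clause P) (can_type clause_encodeK).
End ClauseChoice.

Definition lit_formula (P : choiceType) (l : literal P) : formula P :=
  if l.2 then Prop_ l.1 else Not (Prop_ l.1).

Definition conj_formula (P : choiceType) (K : {fset literal P}) : formula P :=
  foldr (fun l A => And (lit_formula l) A) True_ K.

Definition disj_formula (P : choiceType) (D : {fset literal P}) : formula P :=
  foldr (fun l A => Or (lit_formula l) A) False_ D.

Definition clause_lhs (P : choiceType) (c : clause P) : formula P :=
  match c with
  | Initial _ => Start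
  | Step K _ => conj_formula K
  | Sometime K _ => conj_formula K
  end.

Definition clause_rhs (P : choiceType) (c : clause P) : formula P :=
  match c with
  | Initial D => disj_formula D
  | Step _ D => Next (disj_formula D)
  | Sometime _ l => Eventually (lit_formula l)
  end.

Definition clause_formula (P : choiceType) (c : clause P) : formula P :=
  Imp (clause_lhs c) (clause_rhs c).

Definition set_formula (P : choiceType) (S : {fset clause P}) : formula P :=
  Always (foldr (fun c A => And (clause_formula c) A) True_ S).

Definition eventuality (P : choiceType) (S : {fset clause P}) (l : literal P) :
    Prop :=
  exists C : {fset literal P}, Sometime C l \in S.

Definition clause_literals (P : choiceType) (c : clause P) :
    {fset literal P} :=
  match c with
  | Initial D => D
  | Step K D => K `|` D
  | Sometime K l => l |` K
  end.

Definition occurs (P : choiceType) (p : P) (S : {fset clause P}) : Prop :=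
  exists c l, [/\ c \in S, l \in clause_literals c & l.1 = p].

(* The new symbol w_l is [w l]. Only the values of [w] at eventuality literals
   matter. *)
Definition new_symbols (P : choiceType) (w : literal P -> P)
    (S0 : {fset clause P}) : Prop :=
  (forall l, eventuality S0 l -> ~ occurs (w l) S0) /\
  (forall l m, eventuality S0 l -> eventuality S0 m -> w l = w m -> l = m).

Definition aug_clauses (P : choiceType) (w : literal P -> P) (c : clause P) :
    {fset clause P} :=
  match c with
  | Sometime C l =>
      let wl : literal P := (w l, true) in
      [fset Step [fset wl] [fset l; wl];
            Initial (compls C `|` [fset l; wl]);
            Step fset0 (compls C `|` [fset l; wl])]
  | _ => fset0
  end.

Definition Aug (P : choiceType) (w : literal P -> P) (S0 : {fset clause P}) :
    {fset clause P} :=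
  S0 `|` \bigcup_(c <- S0) aug_clauses w c.

(* Classical truth under a valuation, of a literal, a conjunction of literals,
   and a conjunction of disjunctions of literals. *)
Definition lit_true (P : choiceType) (v : pred P) (l : literal P) : bool :=
  v l.1 == l.2.

Definition conj_true (P : choiceType) (v : pred P) (K : {fset literal P}) :
    bool :=
  all (lit_true v) K.

Definition cnf_true (P : choiceType) (v : pred P)
    (B : {fset {fset literal P}}) : bool :=
  all (fun D : {fset literal P} => has (lit_true v) D) B.

(* [snfm T A B]: merging step clauses of T gives A => next B, where B is a
   conjunction of disjunctions of literals. *)
Inductive snfm (P : choiceType) (T : {fset clause P}) :
    {fset literal P} -> {fset {fset literal P}} -> Prop :=
  | snfm_step K D of Step K D \in T : snfm T K [fset D]
  | snfm_merge A C B D of snfm T A C & snfm T B D :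
      snfm T (A `|` B) (C `|` D).

Definition is_loop (P : choiceType) (T : {fset clause P}) (l : literal P)
    (n : nat) (A : 'I_n.+1 -> {fset literal P})
    (B : 'I_n.+1 -> {fset {fset literal P}}) : Prop :=
  forall i : 'I_n.+1,
    [/\ snfm T (A i) (B i),
        forall v : pred P, cnf_true v (B i) -> lit_true v (compl l) &
        forall v : pred P, cnf_true v (B i) -> exists j, conj_true v (A j)].

Definition loop_resolvents (P : choiceType) (w : literal P -> P)
    (C : {fset literal P}) (l : literal P) (A : {fset literal P}) :
    {fset clause P} :=
  [fset Initial (compls C `|` (l |` compls A));
        Step fset0 (compls C `|` (l |` compls A));
        Step [fset (w l, true)] (l |` compls A)].

(* One step of the procedure, from a clause set to the next. Simplifications
   concerning repeated literals, the conjunct true and the disjunct false are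
   identities in the set representation. A left-hand side false, or a
   right-hand side true, shows up as a complementary pair of literals, so the
   remaining simplifications followed by the deletion of false => next A and of
   A => next true amount to [simplify_lhs] and [simplify_rhs]. *)
Inductive trp_step (P : choiceType) (w : literal P -> P) (T : {fset clause P}) :
    {fset clause P} -> Prop :=
  | initial_resolution (A B : {fset literal P}) (p : P)
      of Initial ((p, true) |` A) \in T & Initial ((p, false) |` B) \in T :
      trp_step w T (Initial (A `|` B) |` T)
  | step_resolution (A B C D : {fset literal P}) (p : P)
      of Step C ((p, true) |` A) \in T & Step D ((p, false) |` B) \in T :
      trp_step w T (Step (C `|` D) (A `|` B) |` T)
  | rewrite_false (A : {fset literal P}) of Step A fset0 \in T :
      trp_step w T ([fset Initial (compls A); Step fset0 (compls A)]
                      `|` (T `\ Step A fset0))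
  | simplify_lhs (K D : {fset literal P}) (l : literal P)
      of Step K D \in T & l \in K & compl l \in K :
      trp_step w T (T `\ Step K D)
  | simplify_rhs (K D : {fset literal P}) (l : literal P)
      of Step K D \in T & l \in D & compl l \in D :
      trp_step w T (T `\ Step K D)
  | subsumption (c d : clause P)
      of c \in T & d \in T & c != d
      & valid (Imp (clause_lhs c) (clause_lhs d))
      & valid (Imp (clause_rhs d) (clause_rhs c)) :
      trp_step w T (T `\ c)
  | temporal_resolution (C : {fset literal P}) (l : literal P) (n : nat)
      (A : 'I_n.+1 -> {fset literal P})
      (B : 'I_n.+1 -> {fset {fset literal P}})
      of Sometime C l \in T & is_loop T l A B :
      trp_step w T (T `|` \bigcup_(i <- enum 'I_n.+1) loop_resolvents w C l (A i)).

Definition derives (P : choiceType) (w : literal P -> P) :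
    {fset clause P} -> {fset clause P} -> Prop :=
  clos_refl_trans {fset clause P} (@trp_step P w).

Definition derivable (P : choiceType) (w : literal P -> P)
    (S : {fset clause P}) (c : clause P) : Prop :=
  exists2 T, derives w S T & c \in T.

Definition augmented (P : choiceType) (w : literal P -> P)
    (S : {fset clause P}) : Prop :=
  exists S0 : {fset clause P},
    [/\ new_symbols w S0, Aug w S0 `<=` S &
        forall c, c \in S -> derivable w (Aug w S0) c].

Definition iff_formula (P : Type) (A B : formula P) : formula P :=
  And (Imp A B) (Imp B A).

Definition normal_model (P : choiceType) (w : literal P -> P)
    (S : {fset clause P}) (sigma : model P) : Prop :=
  holds sigma 0 (set_formula S) /\
  forall l, eventuality S l ->
    holds sigma 0 (Always (iff_formula (Prop_ (w l))
      (And (Not (lit_formula l)) (Eventually (lit_formula l))))).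

Definition well_behaved (P : choiceType) (w : literal P -> P)
    (S : {fset clause P}) : Prop :=
  ~ satisfiable (set_formula S) \/ exists sigma, normal_model w S sigma.

(* Main.v *)
(* Fix a finite set X of symbols and let a clause set T determine a graph on the
   valuations of X: its initial nodes satisfy the initial clauses and its edges
   satisfy the step clauses. As long as T is unsatisfiable, further steps of the
   procedure shrink the part of this graph reachable from an initial node, until
   there is no initial node left and resolution of initial clauses yields the
   contradiction.
   - A reachable node u without successor: the step clauses that apply to u
     resolve to some K => next false with K true at u, and rewriting this clause
     makes u unreachable.
   - Otherwise take a walk that ends up visiting all of a bottom strongly
     connected component infinitely often. It is a model of the initial and step
     clauses, so some C => <> l fails on it; hence l is false throughout the
     component, whose nodes give a loop. By the augmentation clauses w_l holds
     from the failure onwards, so the resolvent w_l => next (l \/ ~ A_i) rules out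
     an edge of the walk.
   This holds for every T reachable from S, because each step, deletions
   included, only strengthens both the whole clause set and its initial and step
   clauses taken alone. *)

From Stdlib Require Import Relations Classical.
Require Import Defs.
From mathcomp Require Import all_boot finmap.

Set Implicit Arguments.
Unset Strict Implicit.
Unset Printing Implicit Defensive.

Local Open Scope fset_scope.

(** * Truth of clauses, and models carried backwards along the procedure *)

Section Semantics.
Variables (P : choiceType) (w : literal P -> P).
Implicit Types (sigma : model P) (T : {fset clause P}) (K D : {fset literal P}).
Implicit Types (l : literal P) (c d : clause P) (v : pred P).

Lemma lit_true_compl v l : lit_true v (compl l) = ~~ lit_true v l.
Proof. by rewrite /lit_true /=; case: (v _); case: l.2. Qed.

Lemma holds_lit sigma i l : holds sigma i (lit_formula l) <-> lit_true (sigma i) l.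
Proof.
rewrite /lit_formula /lit_true; case: l.2 => /=; first by case: (sigma i l.1).
by case: (sigma i l.1); split.
Qed.

Lemma holds_conj sigma i K :
  holds sigma i (conj_formula K) <-> conj_true (sigma i) K.
Proof.
rewrite /conj_formula /conj_true; elim: (enum_fset K) => //= l s IH.
by rewrite IH holds_lit; split=> [[-> ->]|/andP[]].
Qed.

Lemma holds_disj sigma i D :
  holds sigma i (disj_formula D) <-> has (lit_true (sigma i)) D.
Proof.
rewrite /disj_formula; elim: (enum_fset D) => //= l s IH.
by rewrite IH holds_lit; split=> [[]-> //|/orP]; rewrite ?orbT.
Qed.

Lemma has_compls v K : has (lit_true v) (compls K) = ~~ conj_true v K.
Proof.
apply/hasP/allPn => [[l /imfsetP[k /= kK ->]]|[k kK vk]].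
  by rewrite lit_true_compl => vk; exists k.
by exists (compl k); rewrite ?lit_true_compl // in_imfset.
Qed.

Lemma has_fsetU v (A B : {fset literal P}) :
  has (lit_true v) (A `|` B) = has (lit_true v) A || has (lit_true v) B.
Proof.
apply/hasP/orP => [[l]|[]/hasP[l lA vl]]; last 2 first.
- by exists l => //; rewrite in_fsetU lA.
- by exists l => //; rewrite in_fsetU lA orbT.
by rewrite in_fsetU => /orP[] lA vl; [left|right]; apply/hasP; exists l.
Qed.

Lemma has_fset1 v l : has (lit_true v) [fset l] = lit_true v l.
Proof.
apply/hasP/idP => [[k /fset1P-> //]|vl]; by exists l; rewrite ?fset11.
Qed.

Lemma conj_trueU v (A B : {fset literal P}) :
  conj_true v (A `|` B) = conj_true v A && conj_true v B.
Proof.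
by apply: negb_inj; rewrite negb_and -!has_compls -has_fsetU /compls imfsetU.
Qed.

Definition clause_true sigma c (i : nat) : bool :=
  match c with
  | Initial D => (i == 0) ==> has (lit_true (sigma i)) D
  | Step K D => conj_true (sigma i) K ==> has (lit_true (sigma i.+1)) D
  | Sometime _ _ => true
  end.

Definition is_sometime c := if c is Sometime _ _ then true else false.

Lemma holds_clause sigma c i : ~~ is_sometime c ->
  holds sigma i (clause_formula c) <-> clause_true sigma c i.
Proof.
case: c => //= [D|K D] _; rewrite holds_disj ?holds_conj.
  by split=> [H|/implyP H /eqP//]; apply/implyP=> /eqP.
by split=> [H|/implyP]; first apply/implyP.
Qed.

(** With [b = false] only initial and step clauses are imposed, which is what a walk in the graph
    guarantees. *)
Definition models (b : bool) sigma T : Prop :=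
  forall c, c \in T -> b || ~~ is_sometime c ->
  forall i, holds sigma i (clause_formula c).

Lemma satisfiable_models T :
  satisfiable (set_formula T) <-> exists sigma, models true sigma T.
Proof.
have E sigma i :
    holds sigma i (foldr (fun c A => And (clause_formula c) A) True_ T) <->
    forall c, c \in T -> holds sigma i (clause_formula c).
  have -> : (forall c, c \in T -> holds sigma i (clause_formula c)) <->
    (forall c, c \in enum_fset T -> holds sigma i (clause_formula c)) by [].
  elim: (enum_fset T) => [|c s IH] /=; first by split.
  rewrite IH; split=> [[Hc Hs] d|H].
    by rewrite inE => /orP[/eqP->|/Hs].
  by split=> [|d ds]; apply: H; rewrite inE ?eqxx ?ds ?orbT.
split=> -[sigma H]; exists sigma.
  by move=> c cT _ i; have /E := H i (leq0n i); apply.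
by move=> /= i _; apply/E => c cT; apply: H.
Qed.

Lemma models_sub b sigma T T' : T `<=` T' -> models b sigma T' -> models b sigma T.
Proof. by move=> /fsubsetP sTT' H c /sTT'; apply: H. Qed.

(* A clause subsumed by a sometime clause is trivial: the eventuality can
   always be made true after the part of the model that the clause speaks
   about. *)
Lemma subsumed_by_sometime sigma c C l i : ~~ is_sometime c ->
  valid (Imp (clause_lhs c) (clause_lhs (Sometime C l))) ->
  valid (Imp (clause_rhs (Sometime C l)) (clause_rhs c)) ->
  holds sigma i (clause_formula c).
Proof.
move=> cs _ H _.
pose tau : model P := fun j => if j <= i.+1 then sigma j else fun=> l.2.
have {}H : holds tau i (clause_rhs c).
  apply: H => /=; exists i.+2; first by rewrite -addn2 leq_addr.
  by apply/holds_lit; rewrite /lit_true /tau ltnn.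
suff: holds sigma i (clause_rhs c) by [].
move: H; case: c cs => [D|K D|//] _ /=; rewrite !holds_disj /tau ?leqnSn ?leqnn //.
Qed.

(** A deleted clause is a tautology or follows from what remains. For [b = false] the delicate case
    is subsumption by a sometime clause, which is then not imposed. *)
Lemma trp_step_models b sigma T T' :
  trp_step w T T' -> models b sigma T' -> models b sigma T.
Proof.
case=> {T'} [A B p _ _|A B C D p _ _|A AT|K D l KT lK clK|K D l KT lD clD|
            c d cT dT cd vl vr|C l n A B _ _].
- by apply: models_sub; apply: fsubsetUr.
- by apply: models_sub; apply: fsubsetUr.
- move=> H c cT cb.
  have [->{c cT cb}|cA] := eqVneq c (Step A fset0); last first.
    by apply: H; rewrite // !inE cA cT !orbT.
  have HI := H (Initial (compls A)); have HS := H (Step fset0 (compls A)).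
  (* Index 0 is covered by the new initial clause, a successor index by the new step clause. *)
  case=> [|i]; apply/holds_clause => //=; rewrite implybF -has_compls.
    have /(_ _ _ 0)/holds_clause := HI; rewrite /= !inE eqxx orbT /=.
    exact.
  have /(_ _ _ i)/holds_clause := HS.
  rewrite /= !inE eqxx !orbT /=; exact.
- move=> H c cT cb.
  have [->{c cT cb} i|cA] := eqVneq c (Step K D); last first.
    by apply: H; rewrite // !inE cA.
  apply/holds_clause => //=; apply/implyP=> /allP KK.
  by have := KK _ clK; rewrite lit_true_compl (KK _ lK).
- move=> H c cT cb.
  have [->{c cT cb} i|cA] := eqVneq c (Step K D); last first.
    by apply: H; rewrite // !inE cA.
  apply/holds_clause => //=; apply/implyP=> _; apply/hasP.
  have [vl|vl] := boolP (lit_true (sigma i.+1) l); first by exists l.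
  by exists (compl l); rewrite // lit_true_compl.
- move=> H a aT ab.
  have [ac|ac] := eqVneq a c; last by apply: H; rewrite // !inE ac.
  move=> i; rewrite {a aT}ac in ab *.
  have dT' : d \in T `\ c by rewrite !inE eq_sym cd.
  have [db|] := boolP (b || ~~ is_sometime d).
    by move=> /(vl sigma) /(H d dT' db) /(vr sigma).
  case: d {cd dT dT'} vl vr => //= [D|K D|C l]; rewrite ?orbT // => vl vr.
  rewrite orbF => bF; rewrite (negPf bF) /= in ab.
  exact: (@subsumed_by_sometime _ _ C l).
- by apply: models_sub; apply: fsubsetUl.
Qed.

Lemma derives_models b sigma T T' :
  derives w T T' -> models b sigma T' -> models b sigma T.
Proof.
elim=> {T T'} [T T' /trp_step_models H|T|T U V _ H1 _ H2] //; first exact: H.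
by move/H2/H1.
Qed.

Lemma loop_resolvents_bigP n (A : 'I_n.+1 -> {fset literal P}) C l c :
  reflect (exists i, c \in loop_resolvents w C l (A i))
    (c \in \bigcup_(i <- enum 'I_n.+1) loop_resolvents w C l (A i)).
Proof.
apply: (iffP (bigfcupP _ _ _ _)) => [[i _ H]|[i H]]; exists i => //.
by rewrite mem_enum.
Qed.

(** No rule produces a sometime clause, so every eventuality met later is one of the starting
    set. *)
Lemma derives_sometime T T' C l :
  derives w T T' -> Sometime C l \in T' -> Sometime C l \in T.
Proof.
elim=> {T T'} [T T' |T|T U V _ H1 _ H2] //; last by move/H2/H1.
case=> {T'} [A B p _ _|A B E D p _ _|A AT|K D k KT lK clK|K D k KT lD clD|
            c d cT dT cd vl vr|E k n A B _ _] => [||||||/fsetUP[//|]];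
  rewrite ?inE ?orFb.
- by case/orP=> // /eqP.
- by case/orP=> // /eqP.
- by case/orP=> [/orP[]/eqP //|/andP[]].
- by case/andP.
- by case/andP.
- by case/andP.
by case/loop_resolvents_bigP=> i; rewrite !inE => /orP[/orP[]|]/eqP.
Qed.

End Semantics.

(** * Completeness of propositional resolution *)

Section Resolution.
Variable P : choiceType.
Implicit Types (D : {fset literal P}) (G : {fset literal P} -> Prop).

(** The axioms are an arbitrary predicate, so that one completeness proof serves both initial
    clauses and the right-hand sides of step clauses applicable at a node. *)
Inductive resolvent G : {fset literal P} -> Prop :=
  | resolvent_ax D of G D : resolvent G D
  | resolvent_cut (A B : {fset literal P}) p of
      resolvent G ((p, true) |` A) & resolvent G ((p, false) |` B) :
      resolvent G (A `|` B).

(* [xs] lists the symbols still undecided at a node of the semantic tree. *)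
Lemma semantic_tree G (xs : seq P) (v : pred P) :
  (forall v : pred P, exists2 D, G D & ~~ has (lit_true v) D) ->
  exists2 D, resolvent G D &
    forall l, l \in D -> l.1 \notin xs /\ ~~ lit_true v l.
Proof.
move=> HG; elim: xs v => [|x xs IH] v.
  have [D GD /hasPn vD] := HG v; exists D; first exact: resolvent_ax.
  by move=> l /vD.
(* Decide [x] as [b]: the only literal on [x] that can occur is the one [b] falsifies. If it occurs
   for both values of [b], the two clauses are cut on [x]; otherwise one of them suffices. *)
have key b : exists2 D, resolvent G D & forall l, l \in D ->
    l = (x, ~~ b) \/ l.1 \notin x :: xs /\ ~~ lit_true v l.
  have [D rD HD] := IH (fun p => if p == x then b else v p).
  exists D => // -[p a] /HD[/= pxs]; rewrite /lit_true /= inE.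
  by have [->|] := eqVneq p x; [case: a b {D rD HD} => -[]; left|right].
have [D1 r1 H1] := key true; have [D0 r0 H0] := key false.
have [x1|x1] := boolP ((x, false) \in D1); last first.
  exists D1 => // l lD; have [lx|//] := H1 l lD.
  by rewrite lx (negPf x1) in lD.
have [x0|x0] := boolP ((x, true) \in D0); last first.
  exists D0 => // l lD; have [lx|//] := H0 l lD.
  by rewrite lx (negPf x0) in lD.
exists ((D0 `\ (x, true)) `|` (D1 `\ (x, false))).
  by apply: (@resolvent_cut _ _ _ x); rewrite fsetD1K.
move=> l; rewrite in_fsetU !in_fsetD1 => /orP[]/andP[lx].
  by case/H0=> // lE; rewrite lE eqxx in lx.
by case/H1=> // lE; rewrite lE eqxx in lx.
Qed.

(** At the root of the semantic tree all of [X] is undecided, so the derived clause has no literal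
    over [X]; as cuts introduce no symbols outside [X], it is empty. *)
Lemma resolution_complete G (X : {fset P}) :
  (forall D l, G D -> l \in D -> l.1 \in X) ->
  (forall v : pred P, exists2 D, G D & ~~ has (lit_true v) D) ->
  resolvent G fset0.
Proof.
move=> GX HG; have [D rD HD] := semantic_tree X xpredT HG.
suff <- : D = fset0 by [].
have DX l : l \in D -> l.1 \in X.
  elim: rD l {HD} => {D} [D GD l|A B p _ IA _ IB l]; first exact: GX.
  rewrite in_fsetU => /orP[lA|lB].
    by apply: IA; rewrite in_fsetU lA orbT.
  by apply: IB; rewrite in_fsetU lB orbT.
apply/fsetP=> l; rewrite in_fset0; apply/negP=> lD.
by have [/negP[]] := HD l lD; apply: DX.
Qed.

Variable w : literal P -> P.

(** Quantifying over all [T1] above [T] lets the second premise of a cut be derived in the set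
    already enlarged for the first. *)
Lemma resolvent_initial T D :
  resolvent (fun D => Initial D \in T) D ->
  forall T1, T `<=` T1 ->
  exists T2, [/\ derives w T1 T2, T1 `<=` T2 & Initial D \in T2].
Proof.
elim=> {D} [D DT T1 /fsubsetP sT|A B p _ IA _ IB T1 sT].
  by exists T1; split; [exact: rt_refl|exact: fsubset_refl|exact: sT].
have [T2 [d2 s2 A2]] := IA T1 sT.
have [T3 [d3 s3 B3]] := IB T2 (fsubset_trans sT s2).
exists (Initial (A `|` B) |` T3); split; last exact: fset1U1.
  apply: rt_trans d2 (rt_trans _ _ _ _ _ d3 (rt_step _ _ _ _ _)).
  by apply: (@initial_resolution _ _ _ _ _ p) B3; apply: (fsubsetP s3).
exact: fsubset_trans s2 (fsubset_trans s3 (fsubsetU1 _ _)).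
Qed.

Lemma resolvent_step T (v : pred P) D :
  resolvent (fun D => exists2 K, Step K D \in T & conj_true v K) D ->
  forall T1, T `<=` T1 ->
  exists T2 K,
    [/\ derives w T1 T2, T1 `<=` T2, Step K D \in T2 & conj_true v K].
Proof.
elim=> {D} [D [K DT vK] T1 /fsubsetP sT|A B p _ IA _ IB T1 sT].
  exists T1, K.
  by split; [exact: rt_refl|exact: fsubset_refl|exact: sT|].
have [T2 [K [d2 s2 A2 vK]]] := IA T1 sT.
have [T3 [L [d3 s3 B3 vL]]] := IB T2 (fsubset_trans sT s2).
exists (Step (K `|` L) (A `|` B) |` T3), (K `|` L).
split; [| |exact: fset1U1|by rewrite conj_trueU vK].
  apply: rt_trans d2 (rt_trans _ _ _ _ _ d3 (rt_step _ _ _ _ _)).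
  by apply: (@step_resolution _ _ _ _ _ _ _ p) B3; apply: (fsubsetP s3).
exact: fsubset_trans s2 (fsubset_trans s3 (fsubsetU1 _ _)).
Qed.

End Resolution.

(** * Walks in a finite graph that keep visiting a bottom component *)

Section Walks.
Local Open Scope nat_scope.
Variables (N : finType) (e : rel N).

(** Take [q] with the fewest reachable nodes among those reachable from [x]: a node reached from [q]
    reaches no fewer, hence the same ones, [q] included. *)
Lemma bottom_component x :
  exists2 q, connect e x q & forall z, connect e q z -> connect e z q.
Proof.
case: (arg_minnP (fun q => #|connect e q|) (connect0 e x)) => q xq qmin.
exists q => // z qz; have zq : connect e z \subset connect e q.
  by apply/subsetP=> y; apply: connect_trans.
have /eqP qzE : #|connect e z| == #|connect e q|.
  by rewrite eqn_leq subset_leq_card // qmin //; apply: connect_trans qz.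
by have /(_ q) := subset_cardP qzE zq; rewrite !inE connect0.
Qed.

Variables (x q z0 : N).
Hypothesis xq : connect e x q.
Hypothesis qz0 : e q z0.
Hypothesis qbot : forall z, connect e q z -> connect e z q.

(** Detours from [q] to [z] and back are appended for one node [z] after another; the edge to [z0]
    makes the first cycle nonempty. *)
Lemma covering_cycle : exists a p,
  [/\ path e q (a :: p), last a p = q &
      forall z, connect e q z -> z \in a :: p].
Proof.
suff [a [p [ep lp Hp]]]: exists a p, [/\ path e q (a :: p), last a p = q &
    forall z, z \in enum N -> connect e q z -> z \in a :: p].
  by exists a, p; split=> // z; apply: Hp; rewrite mem_enum.
elim: (enum N) => [|z s [a [p [ep lp Hp]]]].
  have /connectP[p ep lp] := qbot (connect1 qz0).
  by exists z0, p; split; rewrite //= qz0.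
have [qz|qz] := boolP (connect e q z); last first.
  exists a, p; split=> // y; rewrite inE => /orP[/eqP->|/Hp//].
  by rewrite (negPf qz).
have /connectP[p1 ep1 lp1] := qz; have /connectP[p2 ep2 lp2] := qbot qz.
exists a, (p ++ p1 ++ p2); split=> [||y].
- by move: ep; rewrite /= !cat_path lp ep1 -lp1 ep2 => /andP[-> ->].
- by rewrite !last_cat lp -lp1 -lp2.
rewrite inE => /orP[/eqP-> _|ys qy].
  have := mem_last q p1; rewrite -lp1 -cat_cons !mem_cat inE => /orP[/eqP->|->].
    by rewrite -{1}lp mem_last.
  by rewrite orbT.
by rewrite -cat_cons mem_cat Hp.
Qed.

Lemma fair_walk : exists s : nat -> N,
  [/\ s 0 = x, forall i, e (s i) (s i.+1) &
      forall i z, connect e q z -> exists2 k, i <= k & s k = z].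
Proof.
have [a [p [ep lp Hp]]] := covering_cycle.
have /connectP[p0 ep0 lp0] := xq.
(* A state is the current node with the nodes still to be visited; once these run out the walk is at
   [q] and enters the cycle [a :: p] again. *)
pose next (t : N * seq N) := if t.2 is y :: r then (y, r) else (a, p).
pose t i := iter i next (x, p0).
have tP i : path e (t i).1 (t i).2 /\ last (t i).1 (t i).2 = q.
  elim: i => [|i]; first by rewrite /= -lp0.
  rewrite /t iterS -/(t i) /next; case: (t i) => y [|b r] /= [].
    by move: ep => /= /andP[].
  by move=> /andP[].
have tdrop i k : k <= size (t i).2 ->
    t (k + i) = (last (t i).1 (take k (t i).2), drop k (t i).2).
  elim: k => [|k IH] kt; first by rewrite take0 drop0; case: (t i).
  rewrite addSn /t iterS -/(t (k + i)) IH 1?ltnW // /next /=.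
  by rewrite (drop_nth q kt) (take_nth q kt) last_rcons.
exists (fun i => (t i).1); split=> // [i|i z qz].
  rewrite /t iterS -/(t i) /next; have [] := tP i.
  case: (t i) => y [|b r] /=; last by case/andP.
  by move=> _ ->; case/andP: ep.
have ti : t (size (t i).2 + i) = (q, [::]).
  by rewrite tdrop // take_size drop_size; case: (tP i) => _ ->.
have ti1 : t (size (t i).2 + i).+1 = (a, p) by rewrite /t iterS -/(t _) ti.
(* At [j] a fresh round of the cycle begins, and every [z] occurs in it. *)
set j := (_ + _).+1 in ti1; have ij : i <= j by rewrite ltnW // ltnS leq_addl.
have /(nthP q)[k kp <-] := Hp z qz.
exists (k + j); first by rewrite (leq_trans ij) ?leq_addl.
rewrite tdrop ti1 //=; elim: p a k kp {ep lp Hp next t tP tdrop ti ti1 j ij}.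
  by move=> b [].
by move=> b r IH c [|k] //= kr; apply: IH.
Qed.

End Walks.

(** * Valuations of a finite symbol set as nodes *)

Section Graph.
Variables (P : choiceType) (w : literal P -> P) (X : {fset P}).
Implicit Types (T : {fset clause P}) (K D A : {fset literal P}).
Implicit Types (l : literal P) (v : pred P).

(* A node is a valuation of the symbols in [X]. *)
Local Notation node := {set X}.
Implicit Types x y u : node.

Definition valuation x : pred P :=
  fun p => if insub p is Some i then i \in x else false.

Definition restriction v : node := [set i : X | v (val i)].

Lemma restrictionK v p : p \in X -> valuation (restriction v) p = v p.
Proof. by move=> pX; rewrite /valuation insubT inE. Qed.

(** The symbols [w l] are included because loop resolvents contain them; this keeps every step of
    the procedure over [X]. *)
Definition over T : Prop :=
  (forall c l, c \in T -> l \in clause_literals c -> l.1 \in X) /\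
  (forall C l, Sometime C l \in T -> w l \in X).

Lemma lit_true_restriction v l :
  l.1 \in X -> lit_true (valuation (restriction v)) l = lit_true v l.
Proof. by move=> lX; rewrite /lit_true restrictionK. Qed.

Lemma has_restriction v D : (forall l, l \in D -> l.1 \in X) ->
  has (lit_true (valuation (restriction v))) D = has (lit_true v) D.
Proof. by move=> DX; apply: eq_in_has => l /DX /lit_true_restriction. Qed.

Lemma conj_restriction v K : (forall l, l \in K -> l.1 \in X) ->
  conj_true (valuation (restriction v)) K = conj_true v K.
Proof. by move=> KX; apply: eq_in_all => l /KX /lit_true_restriction. Qed.

Lemma over_sub T T' : T `<=` T' -> over T' -> over T.
Proof.
move=> /fsubsetP sTT' [H1 H2].
by split=> [c l /sTT'|C l /sTT']; [apply: H1|apply: H2].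
Qed.

Lemma over_compls K : (forall l, l \in K -> l.1 \in X) ->
  forall l, l \in compls K -> l.1 \in X.
Proof. by move=> KX l /imfsetP[k /= /KX kX ->]. Qed.

Lemma snfm_over T A B : over T -> snfm T A B -> forall l, l \in A -> l.1 \in X.
Proof.
move=> [oT _]; elim=> {A B} [K D KD l lK|A C B D _ IA _ IB l].
  by apply: oT KD _; rewrite /= in_fsetU lK.
by rewrite in_fsetU => /orP[/IA|/IB].
Qed.

Lemma over_add T T' : over T ->
  (forall c l, c \in T' -> l \in clause_literals c -> l.1 \in X) ->
  (forall c, c \in T' -> ~~ is_sometime c) -> over (T' `|` T).
Proof.
move=> [H1 H2] H1' H2'; split=> [c l|C l]; rewrite in_fsetU => /orP[].
- exact: H1'.
- exact: H1.
- by move/H2'.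
- exact: H2.
Qed.

Lemma trp_step_over T T' : trp_step w T T' -> over T -> over T'.
Proof.
case=> {T'} [A B p TA TB|A B C D p TA TB|A AT|K D l _ _ _|K D l _ _ _|
            c d _ _ _ _ _|C l n A B TC lo] oT;
  try exact: over_sub (fsubD1set _ _) oT.
- apply: over_add => // c; last by move/fset1P->.
  move=> l /fset1P-> /=; rewrite in_fsetU => /orP[] lA.
    by apply: oT.1 TA _; rewrite /= in_fsetU lA orbT.
  by apply: oT.1 TB _; rewrite /= in_fsetU lA orbT.
- apply: over_add => // c; last by move/fset1P->.
  move=> l /fset1P-> /=; rewrite !in_fsetU -orbA => /or4P[] lA.
  + by apply: oT.1 TA _; rewrite /= !in_fsetU lA.
  + by apply: oT.1 TB _; rewrite /= !in_fsetU lA.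
  + by apply: oT.1 TA _; rewrite /= !in_fsetU lA !orbT.
  + by apply: oT.1 TB _; rewrite /= !in_fsetU lA !orbT.
- have AX l : l \in A -> l.1 \in X.
    by move=> lA; apply: oT.1 AT _; rewrite /= in_fsetU lA.
  apply: over_add; first exact: over_sub (fsubD1set _ _) oT.
    move=> c l /fset2P[]-> /=; first exact: over_compls.
    by rewrite fset0U; apply: over_compls.
  by move=> c /fset2P[]->.
rewrite fsetUC; apply: over_add => // c; last first.
  by case/loop_resolvents_bigP=> i; rewrite !inE => /orP[/orP[]|]/eqP->.
have CX k : k \in l |` C -> k.1 \in X by apply: oT.1 TC.
have lX k : k \in [fset l] -> k.1 \in X.
  by move=> kl; apply: CX; rewrite in_fsetU kl.
have CX' := over_compls (fun k (kC : k \in C) => CX k (fset1Ur _ kC)).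
move=> k /loop_resolvents_bigP[i].
have [/(snfm_over oT)/over_compls AX _ _] := lo i.
rewrite !inE => /orP[/orP[]|]/eqP-> /=; rewrite !in_fsetU ?in_fset0 /=.
- by case/or3P=> [/CX'|/lX|/AX].
- by case/or3P=> [/CX'|/lX|/AX].
- by case/or3P=> [/fset1P->|/lX|/AX] //; apply: oT.2 TC.
Qed.

Lemma derives_over T T' : derives w T T' -> over T -> over T'.
Proof.
elim=> {T T'} [T T' /trp_step_over H|T|T U V _ H1 _ H2] //.
by move/H1/H2.
Qed.

(** * The graph determined by a clause set *)

Definition initr T x : bool :=
  all (fun c =>
    if c is Initial D then has (lit_true (valuation x)) D else true) T.

Definition stepr T : rel node := fun x y =>
  all (fun c => if c is Step K D then
    conj_true (valuation x) K ==> has (lit_true (valuation y)) D else true) T.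

Lemma initrP T x : reflect
  (forall D, Initial D \in T -> has (lit_true (valuation x)) D) (initr T x).
Proof.
apply: (iffP allP) => [H D /H//|H [D|K D|K l] //]; exact: H.
Qed.

Lemma steprP T x y : reflect
  (forall K D, Step K D \in T -> conj_true (valuation x) K ->
     has (lit_true (valuation y)) D) (stepr T x y).
Proof.
apply: (iffP allP) => [H K D /H/implyP //|H [D|K D|K l] // KD].
by apply/implyP; apply: H.
Qed.

Definition reach T x : bool :=
  [exists x0, initr T x0 && connect (stepr T) x0 x].

Lemma reach_init T x : initr T x -> reach T x.
Proof. by move=> ix; apply/existsP; exists x; rewrite ix connect0. Qed.

Lemma reach_connect T x y : reach T x -> connect (stepr T) x y -> reach T y.
Proof.
case/existsP=> x0 /andP[ix c0] cxy; apply/existsP; exists x0.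
by rewrite ix (connect_trans c0).
Qed.

Lemma reach_step T x y : reach T x -> stepr T x y -> reach T y.
Proof. by move=> rx /connect1; apply: reach_connect. Qed.

Lemma reach_ind T (Q : node -> Prop) :
  (forall x, initr T x -> Q x) ->
  (forall x y, Q x -> stepr T x y -> Q y) ->
  forall x, reach T x -> Q x.
Proof.
move=> Qi Qs x /existsP[x0 /andP[/Qi Q0 /connectP[p ep ->]]] {x}.
by elim: p x0 Q0 ep => //= y p IH x0 Q0 /andP[/(Qs _ _ Q0)]; apply: IH.
Qed.

(* [(x, None)] stands for the node x, [(x, Some y)] for the edge from x to y. *)
Definition graph T : {set node * option node} :=
  [set a | reach T a.1 && (if a.2 is Some y then stepr T a.1 y else true)].

(** Edges are compared only at nodes reachable for [T'], since a step clause may have been deleted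
    whose left-hand side is false at all of these. *)
Lemma graph_sub T T' :
  (forall x, reach T' x -> reach T x) ->
  (forall x y, reach T' x -> stepr T' x y -> stepr T x y) ->
  graph T' \subset graph T.
Proof.
move=> rT sT; apply/subsetP=> -[x [y|]]; rewrite !inE /= => /andP[rx].
  by move/(sT _ _ rx)->; rewrite rT.
by rewrite rT.
Qed.

Lemma stepr_anti T T' x y : T `<=` T' -> stepr T' x y -> stepr T x y.
Proof. by move=> /fsubsetP sT /steprP H; apply/steprP => K D /sT; apply: H. Qed.

Lemma reach_anti T T' x : T `<=` T' -> reach T' x -> reach T x.
Proof.
move=> sT; move: x; apply: reach_ind => x.
  move=> /initrP H; apply/reach_init/initrP => D DT.
  by apply: H; apply: (fsubsetP sT).
by move=> y rx /(stepr_anti sT); apply: reach_step.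
Qed.

Lemma graph_anti T T' : T `<=` T' -> graph T' \subset graph T.
Proof.
move=> sT; apply: graph_sub => [x|x y _]; first exact: reach_anti.
exact: stepr_anti.
Qed.

Lemma models_walk T (s : nat -> node) :
  initr T (s 0) -> (forall i, stepr T (s i) (s i.+1)) ->
  models false (fun i => valuation (s i)) T.
Proof.
move=> /initrP s0 ss c cT /= cs i; apply/holds_clause => //.
case: c cT {cs} => //= [D|K D] cT; apply/implyP.
  by move/eqP->; apply: s0.
by have /steprP := ss i; apply.
Qed.

(** * Absence of initial nodes, dead ends, and unfulfilled eventualities *)

Lemma no_initial_node T : over T -> (forall x, ~~ initr T x) ->
  derivable w T (Initial fset0).
Proof.
move=> oT noi.
have /(@resolvent_initial _ w T)/(_ T (fsubset_refl _))[T' [dT _ ?]] :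
    resolvent (fun D => Initial D \in T) fset0; last by exists T'.
have DX D l : Initial D \in T -> l \in D -> l.1 \in X by apply: oT.1.
apply: (@resolution_complete _ _ X) => // v.
have /allPn[[D|K D|K l]//= DT vD] := noi (restriction v).
by exists D; rewrite // -has_restriction // => l; apply: DX.
Qed.

Lemma dead_end T u : over T -> reach T u -> (forall y, ~~ stepr T u y) ->
  exists2 T', derives w T T' & graph T' \proper graph T.
Proof.
move=> oT ru nos.
have /(@resolvent_step _ w T)/(_ T (fsubset_refl _))[T' [K [dT sT KT uK]]] :
    resolvent (fun D => exists2 K, Step K D \in T & conj_true (valuation u) K) fset0.
  have DX K D l : Step K D \in T -> l \in D -> l.1 \in X.
    by move=> KD lD; apply: oT.1 KD _; rewrite /= in_fsetU lD orbT.
  apply: (@resolution_complete _ _ X) => [D l [K KD _]|v]; first exact: DX KD.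
  have /allPn[[D|K D|K l]//= KD] := nos (restriction v).
  rewrite negb_imply => /andP[uK vD]; exists D; first by exists K.
  by rewrite -has_restriction // => l; apply: DX KD.
(* Deleting [Step K fset0] brings back no reachable edge: the two new clauses make [K] false at
   every reachable node. *)
pose T2 := [fset Initial (compls K); Step fset0 (compls K)] `|` (T' `\ Step K fset0).
exists T2; first by apply: rt_trans dT (rt_step _ _ _ _ _); apply: rewrite_false.
have IK : Initial (compls K) \in T2 by rewrite !inE eqxx.
have SK : Step fset0 (compls K) \in T2 by rewrite !inE eqxx orbT.
have inT2 c : c \in T -> c != Step K fset0 -> c \in T2.
  by move=> cT cK; rewrite in_fsetU in_fsetD1 cK (fsubsetP sT) ?orbT.
have sT2 x y : ~~ conj_true (valuation x) K -> stepr T2 x y -> stepr T x y.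
  move=> xK /steprP H; apply/steprP=> L D LD xL; apply: (H L) => //.
  apply: inT2 => //; apply/eqP=> -[LK _].
  by move: xK; rewrite -LK xL.
have rT2 x : reach T2 x -> reach T x /\ ~~ conj_true (valuation x) K.
  move: x; apply: reach_ind => x.
    move=> /initrP H; split; last by rewrite -has_compls; apply: H.
    apply/reach_init/initrP => D DT; apply: H; apply: inT2 => //.
    by apply/eqP.
  move=> y [rx xK] xy; split; first exact: reach_step (sT2 _ _ xK xy).
  by have /steprP := xy; rewrite -has_compls => /(_ _ _ SK); apply.
rewrite properE graph_sub /= => [|x /rT2[]|x y /rT2[_] /sT2] //; last exact.
apply/subsetPn; exists (u, None); rewrite !inE /= andbT //.
by apply/negP=> /rT2[_]; rewrite uK.
Qed.

Lemma cnf_trueU v (B C : {fset {fset literal P}}) :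
  cnf_true v (B `|` C) -> cnf_true v B /\ cnf_true v C.
Proof.
by move/allP=> H; split; apply/allP => D DB; apply: H; rewrite in_fsetU DB ?orbT.
Qed.

(** The applicable clauses are merged one by one. One of them must be given to start with, since
    there is no empty merge. *)
Lemma merge_applicable T u :
  (exists K D, Step K D \in T /\ conj_true (valuation u) K) ->
  exists AB : {fset literal P} * {fset {fset literal P}},
    [/\ snfm T AB.1 AB.2, conj_true (valuation u) AB.1 &
        forall v, cnf_true v AB.2 -> forall K D, Step K D \in T ->
          conj_true (valuation u) K -> has (lit_true v) D].
Proof.
case=> K0 [D0 [KD0 uK0]].
suff [AB [HT uA HB]] : exists AB : {fset literal P} * {fset {fset literal P}},
    [/\ snfm T AB.1 AB.2, conj_true (valuation u) AB.1 &
        forall v, cnf_true v AB.2 -> forall K D, Step K D \in enum_fset T ->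
          conj_true (valuation u) K -> has (lit_true v) D].
  by exists AB; split.
have : {subset enum_fset T <= T} by [].
elim: (enum_fset T) => [|c s IH] sT.
  by exists (K0, [fset D0]); split=> //; apply: snfm_step.
have [|[A B] /= [HT uA HB]] := IH; first by move=> d ds; apply: sT; rewrite inE ds orbT.
have cT : c \in T by apply: sT; rewrite inE eqxx.
have [|] := boolP (if c is Step K D then conj_true (valuation u) K else false).
  case: c cT {sT} => // K D KD uK.
  exists (K `|` A, [fset D] `|` B); split=> /=.
  - by apply: snfm_merge HT; apply: snfm_step.
  - by rewrite conj_trueU uK.
  move=> v /cnf_trueU[/allP vD vB] K' D'; rewrite inE => /orP[/eqP[_ ->] _|].
    by apply: vD; rewrite inE.
  exact: HB.
move=> nc; exists (A, B); split=> // v vB K D; rewrite inE => /orP[/eqP cE|].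
  by rewrite -cE /= in nc; rewrite (negPf nc).
exact: HB.
Qed.

(** Merging the step clauses applicable at [u] gives a right-hand side true only at successors of
    [u]. These are again reachable from [q], so they falsify [l] and satisfy the left-hand side
    merged for themselves. *)
Lemma bottom_loop T q l : over T -> l.1 \in X ->
  (forall u, connect (stepr T) q u -> ~~ lit_true (valuation u) l) ->
  exists n (A : 'I_n.+1 -> {fset literal P}) B,
    is_loop T l A B /\ exists j, conj_true (valuation q) (A j).
Proof.
move=> oT lX ql.
pose merged u (AB : {fset literal P} * {fset {fset literal P}}) :=
  connect (stepr T) q u ->
  [/\ snfm T AB.1 AB.2, conj_true (valuation u) AB.1 &
      forall v, cnf_true v AB.2 -> forall K D, Step K D \in T ->
        conj_true (valuation u) K -> has (lit_true v) D].
have [f Hf] : exists f, forall u, merged u (f u).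
  apply: (@fin_all_exists _ _ merged) => u; rewrite /merged.
  have [qu|] := boolP (connect (stepr T) q u); last by exists (fset0, fset0).
  have [|AB HAB] := @merge_applicable T u; last by exists AB.
  (* All symbols get the sign of [l], so [l] is true at [y]. Hence [y] is no successor of [u], and
     the step clause that excludes it applies at [u]. *)
  pose y := restriction (fun=> l.2).
  have : ~~ stepr T u y.
    apply/negP=> uy; have := ql y (connect_trans qu (connect1 uy)).
    by rewrite lit_true_restriction // /lit_true eqxx.
  case/allPn=> -[D|K D|K k] //= KD; rewrite negb_imply => /andP[uK _].
  by exists K, D.
(* There is one index more than [Q] has entries; the last one runs past the list and gives the
   default [q]. *)
pose Q := enum (connect (stepr T) q).
have Qq i : connect (stepr T) q (nth q Q i).
  have [iQ|iQ] := ltnP i (size Q); last by rewrite nth_default ?connect0.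
  by have := mem_nth q iQ; rewrite mem_enum.
have Qex u : connect (stepr T) q u -> exists j : 'I_(size Q).+1, nth q Q j = u.
  move=> qu; have uQ : u \in Q by rewrite mem_enum.
  have jQ : index u Q < (size Q).+1 by rewrite ltnS index_size.
  by exists (Ordinal jQ); rewrite nth_index.
exists (size Q), (fun i => (f (nth q Q i)).1), (fun i => (f (nth q Q i)).2).
split; last first.
  by have [j jq] := Qex q (connect0 _ _); exists j; rewrite jq; case: (Hf q _).
move=> i; have [H1 H2 H3] := Hf _ (Qq i).
have next v : cnf_true v (f (nth q Q i)).2 -> connect (stepr T) q (restriction v).
  move=> /H3 vB; apply: connect_trans (Qq i) (connect1 _).
  apply/steprP=> K D KD /(vB _ _ KD).
  by rewrite has_restriction // => k kD; apply: oT.1 KD _; rewrite /= in_fsetU kD orbT.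
split=> // v /next qv.
  by rewrite lit_true_compl -lit_true_restriction // ql.
have [j jv] := Qex _ qv; exists j; rewrite jv.
have [/(snfm_over oT) AX + _] := Hf _ qv.
by rewrite conj_restriction.
Qed.

(* What the clauses added by the augmentation say about [w l]. *)
Definition aug_sound T : Prop :=
  forall sigma C l, models false sigma T -> Sometime C l \in T ->
  forall i,
    (conj_true (sigma i) C -> lit_true (sigma i) l || sigma i (w l)) /\
    (sigma i (w l) -> lit_true (sigma i.+1) l || sigma i.+1 (w l)).

Lemma derives_aug_sound T T' : derives w T T' -> aug_sound T -> aug_sound T'.
Proof.
move=> dT aT sigma C l sT' CT'.
exact: aT (derives_models dT sT') (derives_sometime dT CT').
Qed.

Lemma failing_eventuality T sigma : ~ satisfiable (set_formula T) ->
  models false sigma T ->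
  exists C l i, [/\ Sometime C l \in T, conj_true (sigma i) C &
    forall k, i <= k -> ~~ lit_true (sigma k) l].
Proof.
move=> uT sT; apply: NNPP => no; apply/uT/satisfiable_models; exists sigma.
move=> c cT _; have [cs|/(sT c cT)//] := boolP (is_sometime c).
case: c cT cs => // C l CT _ i /= /holds_conj iC; apply: NNPP => nl.
apply: no; exists C, l, i; split=> // k ik; apply/negP=> kl.
by apply: nl; exists k => //; apply/holds_lit.
Qed.

Lemma unfulfilled_component T : over T -> aug_sound T ->
  ~ satisfiable (set_formula T) ->
  (exists x, initr T x) -> (forall u, reach T u -> exists y, stepr T u y) ->
  exists2 T', derives w T T' & graph T' \proper graph T.
Proof.
move=> oT aT uT [x ix] nodead.
have [q xq qbot] := bottom_component (stepr T) x.
have [z qz] := nodead q (reach_connect (reach_init ix) xq).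
have [s [s0 ss sfair]] := fair_walk xq qz qbot.
have ms : models false (fun i => valuation (s i)) T.
  by apply: models_walk => //; rewrite s0.
have [C [l [i [CT iC il]]]] := failing_eventuality uT ms.
have lX : l.1 \in X by apply: oT.1 CT _; rewrite /= fset1U1.
have ql u : connect (stepr T) q u -> ~~ lit_true (valuation u) l.
  by move=> /(sfair i)[k ik <-]; apply: il.
have [n [A [B [lo [j qA]]]]] := bottom_loop oT lX ql.
pose T' := T `|` \bigcup_(i <- enum 'I_n.+1) loop_resolvents w C l (A i).
exists T'; first by apply: rt_step; apply: temporal_resolution.
have sT : T `<=` T' by apply: fsubsetUl.
(* If the graph were unchanged, the walk [s] would obey the loop resolvents too. *)
rewrite properEneq graph_anti // andbT; apply/negP=> /eqP gE.
have sr k : reach T (s k).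
  elim: k => [|k IH]; first by rewrite s0 reach_init.
  exact: reach_step (ss k).
have ss' k : stepr T' (s k) (s k.+1).
  have : (s k, Some (s k.+1)) \in graph T by rewrite inE /= sr ss.
  by rewrite -gE inE => /andP[].
(* At [i], [C] holds and [l] fails, which gives [w l]; afterwards [l] keeps failing, which passes
   [w l] on. *)
have wk k : valuation (s (i + k)%N) (w l).
  elim: k => [|k IH].
    by have [/(_ iC)] := aT _ _ _ ms CT i; rewrite addn0 (negPf (il i (leqnn i))).
  have [_ /(_ IH)] := aT _ _ _ ms CT (i + k)%N.
  by rewrite addnS (negPf (il _ _)) // leqW // leq_addr.
(* A visit to [q] after [i] has a predecessor at which [w l] holds. The resolvent for [A j] forbids
   this edge, as [q] falsifies [l] and satisfies [A j]. *)
have [k ik sk] := sfair i.+1 q (connect0 _ _).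
have [m km] : exists m, k = (i + m).+1 by exists (k - i.+1); rewrite -addSn subnKC.
have /steprP/(_ [fset (w l, true)] (l |` compls (A j))) := ss' (i + m)%N.
rewrite -km sk has_fsetU has_fset1 has_compls qA (negPf (ql q (connect0 _ _))).
move=> H; apply/notF/H.
  rewrite in_fsetU; apply/orP; right; apply/loop_resolvents_bigP; exists j.
  by rewrite !inE eqxx orbT.
apply/allP=> b /fset1P->; rewrite /lit_true /=; apply/eqP; exact: wk.
Qed.

(** By induction on the size of the graph: a dead end or, failing that, an unfulfilled eventuality
    shrinks it, and the derived set inherits all hypotheses. *)
Lemma saturation T : over T -> aug_sound T ->
  ~ satisfiable (set_formula T) -> derivable w T (Initial fset0).
Proof.
move: {2}#|graph T| (leqnn #|graph T|) => n.
elim/ltn_ind: n T => n IH T gT oT aT uT.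
have shrink : (exists2 T', derives w T T' & graph T' \proper graph T) ->
    derivable w T (Initial fset0).
  case=> T' dT /proper_card gT'.
  have [|||U dU UI] := IH _ (leq_trans gT' gT) T' (leqnn _).
  - exact: derives_over dT oT.
  - exact: derives_aug_sound dT aT.
  - move=> /satisfiable_models[sigma /(derives_models dT) sT].
    by apply/uT/satisfiable_models; exists sigma.
  by exists U; first exact: rt_trans dT dU.
have [/existsP ei|] := boolP [exists x, initr T x]; last first.
  by rewrite negb_exists => /forallP/(no_initial_node oT).
have [/existsP[u /andP[ru /forallP nu]]|] :=
  boolP [exists u, reach T u && [forall y, ~~ stepr T u y]].
  exact/shrink/(dead_end oT ru).
rewrite negb_exists => /forallP nd; apply/shrink/unfulfilled_component => // u ru.
by have := nd u; rewrite ru negb_forall /= => /existsP[y /negPn uy]; exists y.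
Qed.

End Graph.

(** * From augmented sets to the contradiction *)

Lemma over_exists (P : choiceType) (w : literal P -> P) (T : {fset clause P}) :
  exists X : {fset P}, over w X T.
Proof.
pose syms (c : clause P) : {fset P} := [fset l.1 | l in clause_literals c]
  `|` (if c is Sometime _ l then [fset w l] else fset0).
exists (\bigcup_(c <- T) syms c); split=> [c l cT lc|C l CT].
  by apply/bigfcupP; exists c; rewrite ?cT // in_fsetU in_imfset.
by apply/bigfcupP; exists (Sometime C l); rewrite ?CT // in_fsetU fset11 orbT.
Qed.

(** Neither augmentation nor the procedure creates sometime clauses, so [Sometime C l] stems from
    [S0] and the clauses added for it lie in [S]. *)
Lemma augmented_sound (P : choiceType) (w : literal P -> P)
  (S : {fset clause P}) : augmented w S -> aug_sound w S.
Proof.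
case=> S0 [_ sS dS] sigma C l mS CS i.
have C0 : Sometime C l \in S0.
  have [T dT CT] := dS _ CS; have := derives_sometime dT CT.
  rewrite in_fsetU => /orP[//|/bigfcupP[[D|K D|K k] _] /=]; rewrite !inE //.
  by case/orP=> [/orP[]|]/eqP.
have aug c : c \in aug_clauses w (Sometime C l) -> c \in S.
  move=> cC; apply: (fsubsetP sS); rewrite in_fsetU; apply/orP; right.
  by apply/bigfcupP; exists (Sometime C l); rewrite ?C0.
have lw v : has (lit_true v) [fset l; (w l, true)] = lit_true v l || v (w l).
  by rewrite has_fsetU !has_fset1 /lit_true eqb_id.
split.
  suff : has (lit_true (sigma i)) (compls C `|` [fset l; (w l, true)]).
    by rewrite has_fsetU has_compls lw => /orP[/negPf->|].
  case: i => [|i].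
    have /mS/(_ isT 0)/holds_clause : Initial (compls C `|` [fset l; (w l, true)]) \in S.
      by apply: aug; rewrite !inE eqxx !orbT.
    exact.
  have /mS/(_ isT i)/holds_clause : Step fset0 (compls C `|` [fset l; (w l, true)]) \in S.
    by apply: aug; rewrite !inE eqxx !orbT.
  exact.
move=> wi; rewrite -lw.
have /mS/(_ isT i)/holds_clause : Step [fset (w l, true)] [fset l; (w l, true)] \in S.
  by apply: aug; rewrite !inE eqxx.
move=> /(_ isT) /implyP; apply; apply/allP=> k /fset1P->.
by rewrite /lit_true wi.
Qed.

(* [Initial fset0] is start => false. The procedure is nondeterministic:
   whatever steps it has already performed on S, reaching T, the contradiction
   is derivable from T. *)
Theorem theorem4 (P : choiceType) (w : literal P -> P) (S : {fset clause P}) :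
  augmented w S -> well_behaved w S -> ~ satisfiable (set_formula S) ->
  forall T : {fset clause P}, derives w S T -> derivable w T (Initial fset0).
Proof.
move=> /augmented_sound aS _ uS T dT.
have [X oT] := over_exists w T.
apply: (saturation oT); first exact: derives_aug_sound dT aS.
move=> /satisfiable_models[sigma /(derives_models dT) sT].
by apply/uS/satisfiable_models; exists sigma.
Qed.
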